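(* Let $V^6$ be a symplectic vector space and give $P(V^6)=\mathbb{R}P^5$ its canonical contact structure. Let $i : (\mathbb{R}^2,0)\to\mathbb{R}P^5$ be a Legendre immersion-germ. Suppose that the regular locus $\mathrm{Reg}(\mathrm{Tan}(i))$ of the tangent map-germ is dense in $(\mathbb{R}^4,0)$. Then the tangent variety $\mathrm{Tan}(i) : (\mathbb{R}^4,0)\to\mathbb{R}P^5$ is frontal.
   Context: All manifolds and maps are $C^\infty$. Contact structure. For a symplectic vector space $V$ and $V_1\in P(V)$, let $V_1^s$ be the symplectic orthogonal of $V_1$. The canonical contact structure $\mathcal{D}\subset TP(V)$ is $\mathcal{D}_{V_1}=T_{V_1}P(V_1^s)$. A Legendre immersion-germ $(\mathbb{R}^2,0)\to\mathbb{R}P^5$ is an immersion-germ everywhere tangent to $\mathcal{D}$. Frontal maps. Let $n\le m$. A map(-germ) $f : N^n \to M^m$ is frontal if (i) its regular locus $\mathrm{Reg}(f)=\{x \in N : f \text{ is an immersion at } x\}$ is dense in $N$, and (ii) there is a $C^\infty$ map $\widetilde f : N \to \mathrm{Gr}(n, TM)$ (bundle of tangent $n$-planes of $M$) with $\widetilde f(x) = f_*(T_xN)$ for all $x \in \mathrm{Reg}(f)$. Tangent map. In affine coordinates of $\mathbb{R}P^5$, $\mathrm{Tan}(i):(\mathbb{R}^4,0)\to\mathbb{R}P^5$ is the map-germ $(s_1,s_2,u_1,u_2)\mapsto i(u)+s_1\,\partial i/\partial u_1(u)+s_2\,\partial i/\partial u_2(u)$. *)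

(* Defs.v *)
From HB Require Import structures.
From mathcomp Require Import all_boot all_order all_algebra.
From mathcomp Require Import all_classical all_reals all_analysis.

Set Implicit Arguments.
Unset Strict Implicit.
Unset Printing Implicit Defensive.

Import Order.TTheory GRing.Theory Num.Theory.
Import numFieldNormedType.Exports.

Local Open Scope classical_set_scope.
Local Open Scope ring_scope.

(* C^oo on the open set U: all iterated directional derivatives are
   differentiable at all points of U. *)
Definition smooth_on (R : realType) (E F : normedModType R) (U : set E)
    (f : E -> F) : Prop :=
  forall (vs : seq E) (x : E), U x ->
    differentiable (foldr (fun v g => 'D_v g) f vs) x.

Definition Reg (R : realType) (n m : nat) (f : 'rV[R]_n -> 'rV[R]_m) :
    set 'rV[R]_n :=
  [set x | injective ('d f x)].

(* f_*(T_x R^n) as a linear subspace of T_{f(x)} R^m = R^m. *)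
Definition tangent_image (R : realType) (n m : nat)
    (f : 'rV[R]_n -> 'rV[R]_m) (x : 'rV[R]_n) : {vspace 'rV[R]_m} :=
  limg (linfun ('d f x)).

Definition Gr (R : realType) (k : nat) (W : vectType R) : Type :=
  {L : {vspace W} | \dim L == k}.

(* Standard atlas of the Grassmannian of k-planes of a (k + l)-dimensional
   space W: a basis e of W identifies the matrices A of size k x l with the
   k-planes that are complementary to the span of the last l vectors of e,
   A being sent to the span of the vectors e_i + \sum_j A_ij e_(k+j).
   For k = 1 these are the affine coordinates [e_0 + \sum_j x_j e_(1+j)] of the
   projective space P(W) = Gr 1 W. *)
Definition gr_chart (R : realType) (k l : nat) (W : vectType R)
    (e : (k + l).-tuple W) (A : 'M[R]_(k, l)) : {vspace W} :=
  <<[seq (tnth e (lshift l i) + \sum_(j < l) A i j *: tnth e (rshift k j))%R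
      | i <- enum 'I_k]>>%VS.

Definition gr_dom (R : realType) (k l : nat) (W : vectType R)
    (e : (k + l).-tuple W) : set (Gr k W) :=
  [set L | exists A, gr_chart e A = val L].

Definition gr_coord (R : realType) (k l : nat) (W : vectType R)
    (e : (k + l).-tuple W) (L : Gr k W) : 'M[R]_(k, l) :=
  xget 0 [set A | gr_chart e A = val L].

(* L lies in the domain of the chart given by the basis e. *)
Definition chart_at (R : realType) (k l : nat) (W : vectType R)
    (e : (k + l).-tuple W) (L : Gr k W) : Prop :=
  basis_of fullv e /\ gr_dom e L.

(* A map into the Grassmannian of k-planes of a (k + l)-dimensional space is
   C^oo near x. *)
Definition gr_smooth_at (R : realType) (E : normedModType R) (k l : nat)
    (W : vectType R) (f : E -> Gr k W) (x : E) : Prop :=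
  forall e : (k + l).-tuple W, chart_at e (f x) ->
  exists U : set E, [/\ open_nbhs x U,
    forall y, U y -> gr_dom e (f y) & smooth_on U (gr_coord e \o f)].

(* The bundle Gr(n, T R^m) is R^m x Gr(n, R^m); F is the second component of
   the lift, the first one being f. *)
Definition frontal_germ (R : realType) (n m : nat)
    (f : 'rV[R]_n -> 'rV[R]_m) (x0 : 'rV[R]_n) : Prop :=
  exists U : set 'rV[R]_n, [/\ open_nbhs x0 U,
    smooth_on U f,
    U `<=` closure (U `&` Reg f) &
    exists F : 'rV[R]_n -> Gr n 'rV[R]_m,
      (forall x, U x -> gr_smooth_at (m - n) F x) /\
      (forall x, U x -> Reg f x -> val (F x) = tangent_image f x)].

(* The tangent space at x of the projective subspace P(W) of P(V), in affine
   coordinates: if x is in P(W) then P(W) is an affine subspace of R^m through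
   x, with direction the vectors xi such that x + xi is in P(W). *)
Definition proj_tangent (R : realType) (m : nat) (V : vectType R)
    (e : (1 + m).-tuple V) (W : {vspace V}) (x : 'rV[R]_m) : set 'rV[R]_m :=
  [set xi | (gr_chart e (x + xi) <= W)%VS].

(* D_{V1} = T_{V1} P(V1^s), in affine coordinates. *)
Definition contact_plane (R : realType) (m : nat) (V : vectType R)
    (omega : {skew_symmetric V}) (e : (1 + m).-tuple V) (x : 'rV[R]_m) :
    set 'rV[R]_m :=
  proj_tangent e (orthov omega (gr_chart e x)) x.

(* Properties of map-germs (R^n, 0) -> P(V), dim V = m + 1, are required in
   all affine charts around the image of 0. *)
Definition in_affine_charts (R : realType) (n m : nat) (V : vectType R)
    (f : 'rV[R]_n -> Gr 1 V)
    (P : (1 + m).-tuple V -> ('rV[R]_n -> 'rV[R]_m) -> Prop) : Prop :=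
  forall e : (1 + m).-tuple V, chart_at e (f 0) ->
  (\forall x \near nbhs (0 : 'rV[R]_n), gr_dom e (f x)) /\ P e (gr_coord e \o f).

Definition legendre_immersion_germ (R : realType) (n m : nat)
    (V : vectType R) (omega : {skew_symmetric V})
    (i : 'rV[R]_n -> Gr 1 V) : Prop :=
  in_affine_charts i (fun (e : (1 + m).-tuple V) c =>
    exists U : set 'rV[R]_n, [/\ open_nbhs (0 : 'rV[R]_n) U,
      smooth_on U c,
      forall u, U u -> Reg c u &
      forall u, U u -> forall v, contact_plane omega e (c u) ('d c u v)]).

Definition proj_Reg (R : realType) (n m : nat) (V : vectType R)
    (f : 'rV[R]_n -> Gr 1 V) : set 'rV[R]_n :=
  [set x | forall e : (1 + m).-tuple V, chart_at e (f x) ->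
     Reg (gr_coord e \o f) x].

Definition proj_dense_Reg_germ (R : realType) (n m : nat) (V : vectType R)
    (f : 'rV[R]_n -> Gr 1 V) : Prop :=
  exists2 U : set 'rV[R]_n, open_nbhs (0 : 'rV[R]_n) U &
    U `<=` closure (U `&` proj_Reg m f).

Definition proj_frontal_germ (R : realType) (n m : nat) (V : vectType R)
    (f : 'rV[R]_n -> Gr 1 V) : Prop :=
  in_affine_charts f (fun (_ : (1 + m).-tuple V) c => frontal_germ c 0).

(* The tangent map of i in the affine coordinates given by the basis e; its
   argument is the row (s, u).  The default value of insubd is not used: when e
   is a basis, gr_chart e x is a line. *)
Definition Tan (R : realType) (p m : nat) (V : vectType R)
    (e : (1 + m).-tuple V) (i : 'rV[R]_p -> Gr 1 V) (x : 'rV[R]_(p + p)) :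
    Gr 1 V :=
  let s := lsubmx x in
  let u := rsubmx x in
  let c : 'rV[R]_p -> 'rV[R]_m := gr_coord e \o i in
  insubd (i u) (gr_chart e (c u + \sum_(j < p) s 0 j *: 'D_(delta_mx 0 j) c u)).

(* Main.v *)
Require Import Defs.
From HB Require Import structures.
From mathcomp Require Import all_boot all_order all_algebra.
From mathcomp Require Import all_classical all_reals all_analysis.
From mathcomp Require Import ring.

Set Implicit Arguments.
Unset Strict Implicit.
Unset Printing Implicit Defensive.

Import Order.TTheory GRing.Theory Num.Theory.
Import numFieldNormedType.Exports.

Local Open Scope classical_set_scope.
Local Open Scope ring_scope.

(* Let v(u) be the lift of i(u) to V given by an affine chart.  The Legendre
   condition reads omega(v, dv) = 0; differentiating it and using the symmetry of
   second derivatives, the span of v and its partial derivatives is isotropic.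
   Hence T = v + \sum_j s_j d_j v satisfies omega(v, T) = 0 and omega(d_k v, T) = 0,
   and differentiating the former gives omega(v, dT) = 0.  So Tan(i) is
   tangent at (s, u) to the projective hyperplane P(v(u)^s), by dimension its
   tangent space there at regular points, and this hyperplane depends smoothly
   on u everywhere. *)

(** * Functions of class C^k *)

Section near_differentiable.
Context {R : realType} {E F : normedModType R}.

(** The first-order expansion of [f] at [x] is also one for [g], and uniqueness of the differential
    concludes. *)
Lemma near_eq_differentiable (f g : E -> F) (x : E) :
  (\near x, f x = g x) -> differentiable f x -> differentiable g x.
Proof.
move=> fg df.
have /diff_locallyP[dfc dfE] := df.
have fg0 : \forall y \near 0, f (y + x) = g (y + x).
  move: fg; rewrite (near_shift 0 x); apply: filterS => y /=.
  by rewrite subr0.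
have gE : g \o shift x = cst (g x) + 'd f x +o_ 0 id.
  apply/eqaddoP => eps eps0.
  move/eqaddoP: dfE => /(_ _ eps0) dfE.
  near=> y.
  suff <- : (f \o shift x - (cst (f x) + 'd f x)) y =
            (g \o shift x - (cst (g x) + 'd f x)) y by near: y.
  by rewrite !fctE /= (nbhs_singleton fg) (near fg0 y).
by apply/diff_locallyP; rewrite (diff_unique dfc gE).
Unshelve. all: by end_near. Qed.

End near_differentiable.

Section Ck.
Context {R : realType}.

(* The derivatives of order k are required to be differentiable, hence continuous. *)
Fixpoint Ck (E F : normedModType R) (k : nat) (U : set E) (f : E -> F) : Prop :=
  (forall x, U x -> differentiable f x) /\
  (if k is k'.+1 then forall v, Ck k' U ('D_v f) else True).

Lemma Ck_differentiable (E F : normedModType R) k (U : set E) (f : E -> F) x :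
  Ck k U f -> U x -> differentiable f x.
Proof. by case: k => [|k] [h _]; exact: h. Qed.

Lemma Ck_derive (E F : normedModType R) k (U : set E) (f : E -> F) v :
  Ck k.+1 U f -> Ck k U ('D_v f).
Proof. by move=> [_]; exact. Qed.

Lemma CkW (E F : normedModType R) k (U : set E) (f : E -> F) :
  Ck k.+1 U f -> Ck k U f.
Proof.
elim: k f => [|k IH] f [fd fD]; first by [].
by split=> // v; apply: IH; exact: fD.
Qed.

(** The order-by-order form is the one on which closure properties are proved by induction. *)
Lemma smooth_onP (E F : normedModType R) (U : set E) (f : E -> F) :
  smooth_on U f <-> forall k, Ck k U f.
Proof.
split=> [sf k|cf vs x Ux].
  elim: k f sf => [|k IH] f sf; split=> //; try by move=> x Ux; exact: (sf [::]).
  move=> v; apply: IH => vs x Ux.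
  (* [foldr] differentiates along the last vector of the list first, so an extra innermost
     derivative is an [rcons]. *)
  by have := sf (rcons vs v) x Ux; rewrite foldr_rcons.
elim/last_ind: vs f cf => [|vs v IH] f cf; first exact: (Ck_differentiable (cf 0%N)).
by rewrite foldr_rcons; apply: IH => k; exact: (Ck_derive v (cf k.+1)).
Qed.

Lemma eq_Ck (E F : normedModType R) k (U : set E) (f g : E -> F) :
  open U -> (forall x, U x -> f x = g x) -> Ck k U f -> Ck k U g.
Proof.
move=> oU.
have nearU x : U x -> \forall y \near x, U y by move=> Ux; exact: open_nbhs_nbhs.
elim: k f g => [|k IH] f g fg [fd fD]; (split;
  first by move=> x Ux; apply: near_eq_differentiable (fd x Ux); near=> y;
           apply: fg; near: y; exact: nearU) => // v.
apply: IH (fD v) => x Ux; apply: near_eq_derive; near=> y; apply: fg.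
by near: y; exact: nearU.
Unshelve. all: by end_near. Qed.

Lemma sub_Ck (E F : normedModType R) k (U W : set E) (f : E -> F) :
  U `<=` W -> Ck k W f -> Ck k U f.
Proof.
move=> UW; elim: k f => [|k IH] f [fd fD];
  (split; first by move=> x /UW; exact: fd) => // v.
exact: IH (fD v).
Qed.

Lemma Ck_cst (E F : normedModType R) k (U : set E) (a : F) : Ck k U (fun _ : E => a).
Proof.
elim: k a => [|k IH] a; split=> // v.
by rewrite (_ : 'D_v _ = fun=> 0)//; apply/funext => x; exact: derive_cst.
Qed.

Lemma Ck_id (E : normedModType R) k (U : set E) : Ck k U (id : E -> E).
Proof.
case: k => [|k]; split=> // v.
by rewrite (_ : 'D_v _ = fun=> v); [exact: Ck_cst|apply/funext => x; exact: derive_id].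
Qed.

Lemma CkD (E F : normedModType R) k (U : set E) (f g : E -> F) :
  open U -> Ck k U f -> Ck k U g -> Ck k U (fun x => f x + g x).
Proof.
move=> oU; elim: k f g => [|k IH] f g [fd fD] [gd gD]; (split;
  first by move=> x Ux; apply: differentiableD; [exact: fd|exact: gd]) => // v.
apply: (eq_Ck oU _ (IH _ _ (fD v) (gD v))) => x Ux.
by rewrite deriveD//; apply: diff_derivable; [exact: fd|exact: gd].
Qed.

Lemma Ck_sum (E F : normedModType R) k (U : set E) (I : Type) (r : seq I)
    (f : I -> E -> F) :
  open U -> (forall i, Ck k U (f i)) -> Ck k U (fun x => \sum_(i <- r) f i x).
Proof.
move=> oU cf; elim: r => [|i r IH].
  by under eq_fun do rewrite big_nil; exact: Ck_cst.
by under eq_fun do rewrite big_cons; exact: CkD.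
Qed.

Lemma derive_linear (E F G : normedModType R) (L : {linear F -> G}) (f : E -> F) x v :
  continuous L -> differentiable f x ->
  'D_v (L \o f) x = L ('D_v f x).
Proof.
move=> cL df; rewrite !deriveE//; last first.
  by apply: differentiable_comp => //; exact: linear_differentiable.
rewrite diff_comp//=; last exact: linear_differentiable.
by rewrite (diff_lin _ cL).
Qed.

Lemma Ck_linear (E F G : normedModType R) k (U : set E) (L : {linear F -> G})
    (f : E -> F) :
  open U -> continuous L -> Ck k U f -> Ck k U (L \o f).
Proof.
move=> oU cL; have dL x : differentiable L x by exact: linear_differentiable.
elim: k f => [|k IH] f [fd fD]; (split;
  first by move=> x Ux; apply: differentiable_comp => //; exact: fd) => // v.
apply: (eq_Ck oU _ (IH _ (fD v))) => x Ux.
by rewrite derive_linear//; exact: fd.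
Qed.

Lemma derive_comp_linear (E F G : normedModType R) (L : {linear E -> F})
    (f : F -> G) x v : 'D_v (f \o L) x = 'D_(L v) f (L x).
Proof.
by rewrite /derive; under eq_fun do rewrite /= [L (_ + _)]linearD [L (_ *: _)]linearZ.
Qed.

Lemma Ck_comp_linear (E F G : normedModType R) k (U : set F) (L : {linear E -> F})
    (f : F -> G) :
  continuous L -> Ck k U f -> Ck k (L @^-1` U) (f \o L).
Proof.
move=> cL; have dL x : differentiable L x by exact: linear_differentiable.
elim: k f => [|k IH] f [fd fD]; (split;
  first by move=> x Ux; apply: differentiable_comp => //; exact: fd) => // v.
rewrite (_ : 'D_v _ = 'D_(L v) f \o L); first exact: (IH _ (fD (L v))).
by apply/funext => x; rewrite derive_comp_linear.
Qed.

(** Each term of Leibniz' rule keeps one factor undifferentiated; [CkW] lowers that factor to the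
    order of the induction hypothesis. *)
Lemma CkM (E : normedModType R) k (U : set E) (f g : E -> R) :
  open U -> Ck k U f -> Ck k U g -> Ck k U (fun x => f x * g x).
Proof.
move=> oU; elim: k f g => [|k IH] f g cf cg.
  split=> // x Ux; apply: differentiableM.
    exact: (Ck_differentiable cf Ux).
  exact: (Ck_differentiable cg Ux).
have [fd fD] := cf; have [gd gD] := cg.
split=> [x Ux|v]; first by apply: differentiableM; [exact: fd|exact: gd].
apply: (eq_Ck oU _ (CkD oU (IH _ _ (CkW cf) (gD v)) (IH _ _ (CkW cg) (fD v)))).
move=> x Ux; rewrite deriveM//; apply: diff_derivable; [exact: fd|exact: gd].
Qed.

Lemma CkV (E : normedModType R) k (U : set E) (f : E -> R) :
  open U -> (forall x, U x -> f x != 0) -> Ck k U f -> Ck k U (fun x => (f x)^-1).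
Proof.
move=> oU f0; elim: k f f0 => [|k IH] f f0 cf.
  split=> // x Ux; apply: differentiableV; last exact: f0.
  exact: (Ck_differentiable cf Ux).
have [fd fD] := cf.
split=> [x Ux|v]; first by apply: differentiableV; [exact: fd|exact: f0].
have cV := IH _ f0 (CkW cf).
have := CkM oU (CkM oU (@Ck_cst E R k U (-1)) (CkM oU cV cV)) (fD v).
apply: (eq_Ck oU) => x Ux; rewrite deriveV ?f0//; last exact/diff_derivable/fd.
by rewrite mulN1r -expr2 exprVn.
Qed.

Lemma Ck_coord (E : normedModType R) k (U : set E) (m n : nat)
    (f : E -> 'M[R]_(m, n)) i j :
  open U -> Ck k U f -> Ck k U (fun x => f x i j).
Proof.
move=> oU cf.
have lin : linear (fun M : 'M[R]_(m, n) => M i j : R) by move=> a M N; rewrite !mxE.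
pose L : {linear 'M[R]_(m, n) -> R} := HB.pack (fun M : 'M[R]_(m, n) => M i j : R)
  (GRing.isLinear.Build _ _ _ _ _ lin).
exact: (Ck_linear (L := L) oU (@coord_continuous _ _ _ i j) cf).
Qed.

Lemma Ck_mx (E : normedModType R) k (U : set E) (m n : nat) (f : E -> 'M[R]_(m, n)) :
  open U -> (forall i j, Ck k U (fun x => f x i j)) -> Ck k U f.
Proof.
move=> oU cf.
apply: (@eq_Ck _ _ _ _ (fun x => \sum_i \sum_j f x i j *: delta_mx i j)) => //.
  by move=> x _; rewrite [RHS]matrix_sum_delta.
apply: Ck_sum => // i; apply: Ck_sum => // j.
have lin : linear (fun a : R => a *: (delta_mx i j : 'M[R]_(m, n))).
  by move=> a b c; rewrite scalerDl scalerA.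
pose L : {linear R -> 'M[R]_(m, n)} := HB.pack
  (fun a : R => a *: (delta_mx i j : 'M[R]_(m, n)))
  (GRing.isLinear.Build _ _ _ _ _ lin).
by apply: (Ck_linear (L := L)); [|exact: scalel_continuous|exact: cf].
Qed.

End Ck.

(** * Symmetry of second derivatives *)

Section Schwarz.
Context {R : realType} {E : normedModType R}.

Lemma is_derive_line (f : E -> R) (y v : E) (s : R) :
  differentiable f (s *: v + y) ->
  is_derive s 1 (fun s => f (s *: v + y)) ('D_v f (s *: v + y)).
Proof.
move=> df; have dv : derivable f (s *: v + y) v by exact: diff_derivable.
have rateE : (fun h : R => h^-1 *: (((fun s => f (s *: v + y)) \o shift s) (h *: 1)
       - f (s *: v + y))) =
   (fun h : R => h^-1 *: ((f \o shift (s *: v + y)) (h *: v) - f (s *: v + y))).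
  apply/funext => h /=; congr (_ *: (f _ - _)).
  by rewrite scalerDl addrA; congr (_ *: _ + _ + _); exact: mulr1.
by constructor; rewrite /derivable /derive rateE.
Qed.

(** The mean value theorem is applied twice: along [v] to the difference of [f] on two parallel
    segments, then along [w] to ['D_v f]. *)
Lemma second_difference (U : set E) (f : E -> R) (x v w : E) (h : R) :
  Ck 2 U f -> 0 < h ->
  (forall s t : R, 0 <= s <= h -> 0 <= t <= h -> U (s *: v + (t *: w + x))) ->
  exists2 st : R * R, 0 <= st.1 <= h /\ 0 <= st.2 <= h &
    f (h *: v + (h *: w + x)) - f (h *: v + x) - (f (h *: w + x) - f x) =
    'D_w ('D_v f) (st.1 *: v + (st.2 *: w + x)) * h * h.
Proof.
move=> cf h0 hU.
have hh : 0 <= h <= h by rewrite lexx ltW.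
have h00 : 0 <= (0 : R) <= h by rewrite lexx ltW.
have in01 (s : R) : s \in `[0, h] -> 0 <= s <= h by rewrite in_itv.
have oin01 (s : R) : s \in `]0, h[ -> 0 <= s <= h.
  by move=> /subset_itv_oo_cc; exact: in01.
have da (s : R) : 0 <= s <= h ->
  is_derive s 1 (fun s => f (s *: v + (h *: w + x)) - f (s *: v + x))
    ('D_v f (s *: v + (h *: w + x)) - 'D_v f (s *: v + x)).
  move=> sh; apply: is_deriveB; apply: is_derive_line;
    apply: (Ck_differentiable cf); first exact: hU.
  by rewrite -[x]add0r -[0](scale0r w); exact: hU.
have [|s sh sE] := MVT h0 (fun s sh => da s (oin01 s sh)).
  apply: derivable_within_continuous => s /in01 sh.
  by have [] := da s sh.
have db (t : R) : 0 <= t <= h ->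
  is_derive t 1 (fun t => 'D_v f (t *: w + (s *: v + x)))
    ('D_w ('D_v f) (t *: w + (s *: v + x))).
  move=> th; apply: is_derive_line; apply: (Ck_differentiable (Ck_derive v cf)).
  by rewrite addrCA; apply: hU => //; exact: oin01.
have [|t th tE] := MVT h0 (fun t th => db t (oin01 t th)).
  apply: derivable_within_continuous => t /in01 th.
  by have [] := db t th.
exists (s, t) => /=; first by split; exact: oin01.
rewrite /= !scale0r !add0r !subr0 in sE tE *.
by rewrite sE addrCA tE addrCA.
Qed.

Lemma derive_comm (U : set E) (f : E -> R) (x v w : E) :
  open U -> Ck 2 U f -> U x -> 'D_w ('D_v f) x = 'D_v ('D_w f) x.
Proof.
move=> oU cf Ux; pose A : E -> R := 'D_w ('D_v f); pose B : E -> R := 'D_v ('D_w f).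
have cont (a b : E) : {for x, continuous ('D_b ('D_a f))}.
  apply: differentiable_continuous.
  exact: (Ck_differentiable (Ck_derive b (Ck_derive a cf)) Ux).
have cA : {for x, continuous A} := cont v w.
have cB : {for x, continuous B} := cont w v.
(* The second difference is symmetric in v and w. *)
have sdA h h0 hU : exists2 st : R * R, 0 <= st.1 <= h /\ 0 <= st.2 <= h &
    f (h *: v + (h *: w + x)) - f (h *: v + x) - (f (h *: w + x) - f x) =
    A (st.1 *: v + (st.2 *: w + x)) * h * h := second_difference cf h0 hU.
have sdB h h0 hU : exists2 st : R * R, 0 <= st.1 <= h /\ 0 <= st.2 <= h &
    f (h *: w + (h *: v + x)) - f (h *: w + x) - (f (h *: v + x) - f x) =
    B (st.1 *: w + (st.2 *: v + x)) * h * h := second_difference cf h0 hU.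
rewrite -/(A x) -/(B x); clearbody A B; clear cont.
(* Otherwise, near [x], the values of [A] and [B] stay within half of the gap from [A x] and [B x],
   so that no value of [A] there is a value of [B]. *)
apply/eqP; rewrite -subr_eq0 -normr_le0 leNgt; apply/negP => AB.
have e0 : 0 < `|A x - B x| / 2 by rewrite divr_gt0.
have near_ABU : \forall y \near x,
    [/\ `|A x - A y| < `|A x - B x| / 2, `|B x - B y| < `|A x - B x| / 2 & U y].
  have nA : \forall y \near x, `|A x - A y| < `|A x - B x| / 2.
    exact: ((cvgrPdist_lt _ _).1 cA _ e0).
  have nB : \forall y \near x, `|B x - B y| < `|A x - B x| / 2.
    exact: ((cvgrPdist_lt _ _).1 cB _ e0).
  have nU : \forall y \near x, U y by exact: open_nbhs_nbhs.
  by apply: filterS3 nA nB nU => y Ay By Uy.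
have [d /= d0 dABU] := (nbhs_ballP _ _).1 near_ABU.
(* With this side the parallelogram at [x] lies in the ball of radius [d]; the summand 1 keeps the
   denominator positive when [v] and [w] vanish. *)
pose h := d / (`|v| + `|w| + 1).
have D0 : 0 < `|v| + `|w| + 1 by rewrite ltr_wpDl// addr_ge0.
have h0 : 0 < h by rewrite divr_gt0.
have small (s t : R) : 0 <= s <= h -> 0 <= t <= h -> ball x d (s *: v + (t *: w + x)).
  move=> /andP[s0 sh] /andP[t0 th].
  rewrite -ball_normE /ball_/= addrA opprD addrCA subrr addr0 normrN.
  apply: (@le_lt_trans _ _ (h * (`|v| + `|w|))).
    rewrite (le_trans (ler_normD _ _))// mulrDr !normrZ !ger0_norm//.
    by rewrite lerD// ler_wpM2r.
  by rewrite /h mulrAC ltr_pdivrMr// ltr_pM2l// ltrDl.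
have [|st [s_h t_h] stE] := sdA h h0.
  by move=> s t sh th; have [] := dABU _ (small _ _ sh th).
have [|ts [s'h t'h] tsE] := sdB h h0.
  by move=> s t sh th; rewrite addrCA; have [] := dABU _ (small _ _ th sh).
have [Ap _ _] := dABU _ (small _ _ s_h t_h).
have [_ Bq _] := dABU _ (small _ _ t'h s'h).
move: stE tsE Ap Bq; rewrite (addrCA (h *: w)) (addrCA (ts.1 *: w)).
set a := A (_ + _); set b := B (_ + _) => stE tsE Ap Bq.
have ab : a = b.
  apply: (mulIf (lt0r_neq0 h0)); apply: (mulIf (lt0r_neq0 h0)).
  by rewrite -stE -tsE; ring.
have := ltrD Ap Bq; rewrite -splitr ltNge ab => /negP; apply.
by rewrite (distrC (B x)) (ler_distD b).
Qed.

End Schwarz.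

(** * Charts of Grassmannians and projective spaces *)

Section charts.
Context {R : realType} {V : vectType R}.

Definition chart_vec (k l : nat) (e : (k + l).-tuple V) (A : 'M[R]_(k, l))
    (i : 'I_k) : V :=
  tnth e (lshift l i) + \sum_(j < l) A i j *: tnth e (rshift k j).

Lemma mem_chart_vec (k l : nat) (e : (k + l).-tuple V) (A : 'M[R]_(k, l)) i :
  chart_vec e A i \in gr_chart e A.
Proof.
by apply: memv_span; apply/mapP; exists i => //; rewrite mem_enum.
Qed.

Lemma gr_chart_subv (k l : nat) (e : (k + l).-tuple V) (A : 'M[R]_(k, l))
    (W : {vspace V}) :
  (forall i, chart_vec e A i \in W) -> (gr_chart e A <= W)%VS.
Proof. by move=> AW; apply/span_subvP => _ /mapP[i _ ->]; exact: AW. Qed.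

Lemma coord_tnth n (e : n.-tuple V) (i j : 'I_n) :
  basis_of fullv e -> coord e i (tnth e j) = (j == i)%:R.
Proof. by move=> be; rewrite (tnth_nth 0) coord_free// (basis_free be). Qed.

Lemma coord_chart_vec_l (k l : nat) (e : (k + l).-tuple V) A (i i' : 'I_k) :
  basis_of fullv e -> coord e (lshift l i') (chart_vec e A i) = (i == i')%:R.
Proof.
move=> be; rewrite linearD linear_sum/= coord_tnth// big1 ?addr0.
  by rewrite eq_lshift.
by move=> j _; rewrite linearZ/= coord_tnth// eq_rlshift mulr0.
Qed.

Lemma coord_chart_vec_r (k l : nat) (e : (k + l).-tuple V) A i (j : 'I_l) :
  basis_of fullv e -> coord e (rshift k j) (chart_vec e A i) = A i j.
Proof.
move=> be; rewrite linearD linear_sum/= coord_tnth// eq_lrshift add0r.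
rewrite (bigD1 j)//= big1 ?addr0; last first.
  move=> j' /negPf j'j; rewrite linearZ/= coord_tnth// eq_rshift j'j.
  exact: mulr0.
by rewrite linearZ/= coord_tnth// eqxx; exact: mulr1.
Qed.

(** The plane is the graph of the linear map of matrix [A]. Its equations are linear in [w], so
    checking them on the generators suffices; conversely they make [w] the combination of the
    generators weighted by its first [k] coordinates. *)
Lemma gr_chartP (k l : nat) (e : (k + l).-tuple V) (A : 'M[R]_(k, l)) (w : V) :
  basis_of fullv e ->
  reflect (forall j, coord e (rshift k j) w =
                     \sum_(i < k) coord e (lshift l i) w * A i j)
          (w \in gr_chart e A).
Proof.
move=> be; apply: (iffP idP) => [wA j|wA].
  pose f := fun w : V => (coord e (rshift k j) w -
    \sum_(i < k) coord e (lshift l i) w * A i j : R^o).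
  have linf : linear f.
    move=> a u v; rewrite /f linearP/= scalerBr addrACA -opprD; congr (_ - _).
    rewrite scaler_sumr -big_split/=; apply: eq_bigr => i _.
    by rewrite linearP/= mulrDl -mulrA.
  pose F : {linear V -> R^o} := HB.pack f (GRing.isLinear.Build _ _ _ _ _ linf).
  have /subvP/(_ _ wA) : (gr_chart e A <= lker (linfun F))%VS.
    apply: gr_chart_subv => i; rewrite memv_ker lfunE/= /f.
    rewrite coord_chart_vec_r// (bigD1 i)//= coord_chart_vec_l// eqxx mul1r.
    rewrite big1 ?addr0 ?subrr// => i' /negPf i'i.
    by rewrite coord_chart_vec_l// eq_sym i'i mul0r.
  by rewrite memv_ker lfunE/= /f subr_eq0 => /eqP.
have -> : w = \sum_(i < k) coord e (lshift l i) w *: chart_vec e A i.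
  rewrite [LHS](coord_basis be (memvf w)) big_split_ord/=.
  under [RHS]eq_bigr do rewrite scalerDr scaler_sumr.
  rewrite big_split/=; congr (_ + _).
    by apply: eq_bigr => i _; rewrite (tnth_nth 0).
  rewrite exchange_big/=; apply: eq_bigr => j _.
  rewrite wA scaler_suml; apply: eq_bigr => i _.
  by rewrite scalerA (tnth_nth 0).
by apply: rpred_sum => i _; apply/rpredZ/mem_chart_vec.
Qed.

Lemma gr_chart_inj (k l : nat) (e : (k + l).-tuple V) :
  basis_of fullv e -> injective (gr_chart e).
Proof.
move=> be A B AB; apply/matrixP => i j.
have := mem_chart_vec e A i; rewrite AB => /(gr_chartP _ _ be)/(_ j).
rewrite coord_chart_vec_r// => ->.
rewrite (bigD1 i)//= big1 => [|i' /negPf i'i]; rewrite coord_chart_vec_l//.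
  by rewrite eqxx mul1r addr0.
by rewrite eq_sym i'i mul0r.
Qed.

(** Injectivity of the chart identifies the matrix picked by [xget] with any explicit one;
    smoothness of [gr_coord] is read off explicit formulas in this way. *)
Lemma gr_coordE (k l : nat) (e : (k + l).-tuple V) (A : 'M[R]_(k, l)) (L : Gr k V) :
  basis_of fullv e -> gr_chart e A = val L -> gr_coord e L = A.
Proof.
move=> be AL; rewrite /gr_coord; apply: xget_unique => //= B BL.
by apply: (gr_chart_inj be); rewrite AL.
Qed.

End charts.

(** * Lifts to [V] of affine coordinates on the projective space *)

Section affine_charts.
Context {R : realType} {V : vectType R} {m : nat}.
Implicit Types (e : (1 + m).-tuple V) (x y xi : 'rV[R]_m).

Definition lift_dir e xi : V := \sum_(j < m) xi 0 j *: tnth e (rshift 1 j).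

Lemma lift_dir_is_linear e : linear (lift_dir e).
Proof.
move=> a x y; rewrite /lift_dir scaler_sumr -big_split/=; apply: eq_bigr => j _.
by rewrite !mxE scalerDl scalerA.
Qed.
HB.instance Definition _ e :=
  GRing.isLinear.Build _ _ _ _ (lift_dir e) (lift_dir_is_linear e).

(** For a basis [e], this is the vector with first coordinate 1 on the line [gr_chart e x]; the form
    [omega] can be evaluated on it. *)
Definition lift_pt e x : V := tnth e (lshift m 0) + lift_dir e x.

Lemma lift_ptD e x xi : lift_pt e (x + xi) = lift_pt e x + lift_dir e xi.
Proof. by rewrite /lift_pt linearD addrA. Qed.

Lemma gr_chart1E e x : gr_chart e x = <[lift_pt e x]>%VS.
Proof. by rewrite /gr_chart enum_ordSl enum_ord0/= span_seq1. Qed.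

Lemma lift_pt_neq0 e x : basis_of fullv e -> lift_pt e x != 0.
Proof.
move=> be; apply/eqP => x0; have := @coord_chart_vec_l _ _ _ _ e x 0 0 be.
rewrite -[chart_vec _ _ _]/(lift_pt e x) x0 linear0 eqxx => /esym/eqP.
by rewrite oner_eq0.
Qed.

Lemma dim_gr_chart1 e x : basis_of fullv e -> \dim (gr_chart e x) = 1%N.
Proof. by move=> be; rewrite gr_chart1E dim_vline lift_pt_neq0. Qed.

(** Dehomogenisation: dividing by the nonzero first coordinate gives the affine coordinates of the
    line through [w]. *)
Lemma lift_pt_basis e w : basis_of fullv e ->
  coord e (lshift m 0) w != 0 ->
  w = coord e (lshift m 0) w *:
      lift_pt e (\row_j (coord e (rshift 1 j) w / coord e (lshift m 0) w)).
Proof.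
move=> be w0; rewrite scalerDr [LHS](coord_basis be (memvf w)) big_split_ord/=.
rewrite big_ord1 (tnth_nth 0); congr (_ + _).
rewrite scaler_sumr; apply: eq_bigr => j _.
by rewrite mxE scalerA mulrCA divff// mulr1 (tnth_nth 0).
Qed.

Lemma gr_chart1_coord_neq0 e w x : basis_of fullv e -> w != 0 ->
  w \in gr_chart e x -> coord e (lshift m 0) w != 0.
Proof.
move=> be w0; rewrite gr_chart1E => /vlineP[a wE]; move: w0; rewrite wE.
rewrite scaler_eq0 negb_or linearZ/= => /andP[a0 _].
rewrite -[lift_pt e x]/(chart_vec e x 0) coord_chart_vec_l// eqxx.
by rewrite mulr1.
Qed.

End affine_charts.

(** * Hyperplanes cut out by a linear form *)

Section hyperplane.
Context {R : realType} {n : nat}.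
Implicit Types a w : 'rV[R]_n.

Definition hyperplane a : {vspace 'rV[R]_n} :=
  lker (linfun (mulmxr a^T : 'rV[R]_n -> 'rV[R]_1)).

Lemma mem_hyperplane a w :
  (w \in hyperplane a) = (\sum_(j < n) w 0 j * a 0 j == 0).
Proof.
rewrite memv_ker lfunE/=; apply/eqP/eqP => [/rowP/(_ 0)|w0].
  by rewrite !mxE => w0; rewrite -[RHS]w0; apply: eq_bigr => j _; rewrite mxE.
apply/rowP => j; rewrite !mxE ord1 -[RHS]w0.
by apply: eq_bigr => i _; rewrite mxE.
Qed.

(** Rank-nullity: a nonzero entry of [a] makes the form nonzero on a basis vector, so its image is a
    line. *)
Lemma dim_hyperplane a : a != 0 -> \dim (hyperplane a) = n.-1.
Proof.
move=> a0; have := limg_ker_dim (linfun (mulmxr a^T : 'rV[R]_n -> 'rV[R]_1)) fullv.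
rewrite capfv -/(hyperplane a) dimvf [dim _]mul1n.
set d := \dim (limg _); suff -> : d = 1%N by rewrite addn1 => /(congr1 predn).
apply/eqP; rewrite eqn_leq; apply/andP; split.
  by rewrite (leq_trans (dimvS (subvf _)))// dimvf.
rewrite lt0n dimv_eq0; apply: contra a0 => /eqP im0.
apply/eqP/rowP => j; rewrite mxE.
have : linfun (mulmxr a^T : 'rV[R]_n -> 'rV[R]_1) (delta_mx 0 j) \in 0%VS.
  by rewrite -im0 memv_img// memvf.
rewrite memv0 lfunE/= -rowE => /eqP/rowP/(_ 0).
by rewrite !mxE.
Qed.

End hyperplane.

(** * Smooth families of hyperplanes *)

(** Coordinates of lifts, and values of [omega] between a lift and a fixed vector, are affine in the
    chart coordinates; this covers both. *)
Lemma Ck_affine (R : realType) (E : normedModType R) m d (U : set E)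
    (f : E -> 'rV[R]_m) (h : E -> R) (a : R) (b : 'I_m -> R) :
  open U -> Ck d U f -> (forall y, h y = a + \sum_(j < m) f y 0 j * b j) -> Ck d U h.
Proof.
move=> oU cf hE; rewrite (funext hE); apply: CkD => //; first exact: Ck_cst.
apply: Ck_sum => // j; apply: CkM => //; last exact: Ck_cst.
exact: Ck_coord cf.
Qed.

Section smooth_tools.
Context {R : realType}.

Lemma open_neq0 (E : normedModType R) (U : set E) (f : E -> R) :
  open U -> (forall x, U x -> differentiable f x) ->
  open (U `&` [set x | f x != 0]).
Proof.
move=> oU df; rewrite openE => x [Ux fx0].
have cf : {for x, continuous f} by exact/differentiable_continuous/df.
have nf : \forall y \near x, f y != 0 by exact: cvgr_neq0 cf fx0.
have nU : \forall y \near x, U y by exact: open_nbhs_nbhs.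
by apply: filterS2 nU nf => y.
Qed.

Lemma rV_linear_continuous (F : normedModType R) n (L : {linear 'rV[R]_n -> F}) :
  continuous L.
Proof.
have cL : Ck 0 [set: 'rV[R]_n] (fun x => \sum_(j < n) x 0 j *: L (delta_mx 0 j)).
  apply: Ck_sum => [|j]; first exact: openT.
  split=> // x _; apply: differentiableZl; exact: differentiable_coord.
move=> x; apply/differentiable_continuous.
rewrite (_ : L = (fun x => \sum_(j < n) x 0 j *: L (delta_mx 0 j)) :> (_ -> _)).
  exact: (Ck_differentiable cL).
apply/funext => y; rewrite {1}(row_sum_delta y) linear_sum/=.
by apply: eq_bigr => j _; rewrite [LHS]linearZ.
Qed.

(** The scalar case applied entrywise: taking an entry is linear and continuous, so it commutes with
    derivatives. *)
Lemma derive_comm_mx (E : normedModType R) (m n : nat) (U : set E)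
    (f : E -> 'M[R]_(m, n)) (x v w : E) :
  open U -> Ck 2 U f -> U x -> 'D_w ('D_v f) x = 'D_v ('D_w f) x.
Proof.
move=> oU cf Ux; apply/matrixP => i j.
have lin : linear (fun M : 'M[R]_(m, n) => M i j : R) by move=> a M N; rewrite !mxE.
pose L : {linear 'M[R]_(m, n) -> R} := HB.pack (fun M : 'M[R]_(m, n) => M i j : R)
  (GRing.isLinear.Build _ _ _ _ _ lin).
have cL : continuous L by exact: coord_continuous.
have LE (a b : E) : L ('D_b ('D_a f) x) = 'D_b ('D_a (L \o f)) x.
  have [Da _] := Ck_derive a cf.
  rewrite -derive_linear//; last exact: Da.
  have nU : \forall y \near x, U y by exact: open_nbhs_nbhs.
  apply: near_eq_derive; apply: filterS nU => y Uy.
  by rewrite derive_linear//; exact: (Ck_differentiable cf).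
have := derive_comm v w oU (Ck_linear oU cL cf) Ux.
by rewrite -!LE.
Qed.

(** In a chart around [F x] the last basis vector [b] is transverse to the hyperplane, so near [x]
    the equation can be solved for the last coordinate, with a smooth quotient as solution. *)
Lemma gr_smooth_hyperplane (E : normedModType R) n k (U : set E) (a : E -> 'rV[R]_n)
    (F : E -> Gr k 'rV[R]_n) (x : E) :
  open U -> smooth_on U a -> (forall y, U y -> val (F y) = hyperplane (a y)) ->
  U x -> a x != 0 -> gr_smooth_at 1 F x.
Proof.
move=> oU sa FE Ux ax0 e [be [A0 A0E]].
pose q (w : 'rV[R]_n) y : R := \sum_(j < n) w 0 j * a y 0 j.
have cq w d : Ck d U (q w).
  apply: Ck_sum => // j; apply: CkM => //; first exact: Ck_cst.
  exact: (Ck_coord 0 j oU ((smooth_onP _ _).1 sa d)).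
have memq y w : U y -> (w \in val (F y)) = (q w y == 0).
  by move=> Uy; rewrite FE// mem_hyperplane.
have q_is_linear y : linear (fun w => q w y : R^o).
  move=> b w1 w2; rewrite /q scaler_sumr -big_split/=; apply: eq_bigr => j _.
  by rewrite !mxE mulrDl -mulrA.
pose Q y : {linear 'rV[R]_n -> R^o} := HB.pack (fun w => q w y : R^o)
  (GRing.isLinear.Build _ _ _ _ _ (q_is_linear y)).
pose b := tnth e (rshift k 0).
have qE w y : q w y = \sum_(i < k) coord e (lshift 1 i) w * q (tnth e (lshift 1 i)) y +
    coord e (rshift k 0) w * q b y.
  rewrite -[LHS]/(Q y w) {1}(coord_basis be (memvf w)) (linear_sum (Q y)).
  rewrite big_split_ord big_ord1; congr (_ + _); [apply: eq_bigr => i _|];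
    by rewrite [LHS]linearZ -tnth_nth.
(* Row [i] solves [q (e_i + A_i b) y = 0], where [e_i] is one of the first [k] basis vectors. *)
pose A y : 'M[R]_(k, 1) := \matrix_(i, j) (- (q (tnth e (lshift 1 i)) y * (q b y)^-1)).
(* The generators [e_i + A0_i b] lie in [F x]. If the form also killed [b], it would kill every
   [e_i], and [a x] would be zero. *)
have qx0 : q b x != 0.
  apply: contra_neqN ax0 => /eqP qb0.
  have qi i : q (tnth e (lshift 1 i)) x = 0.
    have := mem_chart_vec e A0 i; rewrite A0E memq// /chart_vec big_ord1 => /eqP.
    rewrite -/b addrC -[q _ _]/(Q x _) (linearP (Q x)) [Q x b]qb0.
    by rewrite [X in X + _]mulr0 add0r.
  have q0 w : q w x = 0.
    by rewrite qE qb0 mulr0 addr0 big1// => i _; rewrite qi mulr0.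
  apply/rowP => j; rewrite mxE -(q0 (delta_mx 0 j)) /q (bigD1 j)//= mxE !eqxx.
  rewrite mul1r big1 ?addr0// => i /negPf ij.
  by rewrite mxE eqxx ij mul0r.
pose U' := U `&` [set y | q b y != 0].
have oU' : open U' by apply: open_neq0 => // y Uy; exact: Ck_differentiable (cq b 0%N) Uy.
have AE y : U' y -> gr_chart e (A y) = val (F y).
  move=> [/= Uy qy0]; apply/vspaceP => w; rewrite memq//.
  pose S := \sum_(i < k) coord e (lshift 1 i) w * q (tnth e (lshift 1 i)) y.
  have AE j : \sum_(i < k) coord e (lshift 1 i) w * A y i j = - (S / q b y).
    rewrite mulr_suml -sumrN; apply: eq_bigr => i _.
    by rewrite mxE mulrN mulrA.
  apply/(gr_chartP _ _ be)/idP => [/(_ 0)|qw0 j]; rewrite AE.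
    by rewrite [q w y]qE -/S => ->; rewrite mulNr divfK// subrr.
  rewrite (ord1 j); apply: (mulIf qy0); rewrite mulNr divfK//.
  by apply/eqP; rewrite -addr_eq0 addrC -[S + _]qE.
exists U'; split; first by split.
- by move=> y U'y; exists (A y); exact: AE.
- apply/smooth_onP => d; apply: (@eq_Ck _ _ _ _ _ A) => //.
    by move=> y U'y; rewrite /= (gr_coordE be (AE y U'y)).
  apply: Ck_mx => // i j.
  have cqU w : Ck d U' (q w) by apply: sub_Ck (cq w d) => y [].
  under eq_fun do rewrite mxE -mulN1r.
  apply: CkM => //; first exact: Ck_cst.
  by apply: CkM => //; apply: CkV => // y [].
Qed.

End smooth_tools.

(** * Legendre maps and their tangent maps *)

Section isotropy.
Context {R : realType} {V : vectType R} (omega : {skew_symmetric V}).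

Lemma derive_form_l (E : normedModType R) m (e : (1 + m).-tuple V) (a w : V)
    (f : E -> 'rV[R]_m) (x v : E) : differentiable f x ->
  is_derive x v (fun y => omega (a + lift_dir e (f y)) w)
    (omega (lift_dir e ('D_v f x)) w).
Proof.
move=> df.
have lin : linear (fun xi => omega (lift_dir e xi) w : R).
  by move=> b xi1 xi2; rewrite linearP linearDl linearZl.
pose L : {linear 'rV[R]_m -> R} := HB.pack (fun xi => omega (lift_dir e xi) w : R)
  (GRing.isLinear.Build _ _ _ _ _ lin).
have cL : continuous L by exact: rV_linear_continuous.
rewrite (_ : (fun y => _) = cst (omega a w) + (L \o f)); last first.
  by apply/funext => y; rewrite linearDl.
rewrite -[omega (lift_dir _ _) w]/(L _) -(derive_linear v cL df).
rewrite -[X in is_derive _ _ _ X]add0r.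
apply: is_deriveD; apply/derivableP/diff_derivable.
by apply: differentiable_comp => //; exact: linear_differentiable.
Qed.

(** Leibniz' rule for [omega], by expanding the second argument on [e']. The constants [a] and [a']
    are chart origins for lifts of points and 0 for lifts of directions; the two arguments may be
    written in different charts. *)
Lemma derive_form (E : normedModType R) m n (e : (1 + m).-tuple V)
    (e' : (1 + n).-tuple V) (a a' : V)
    (f : E -> 'rV[R]_m) (g : E -> 'rV[R]_n) (x v : E) :
  differentiable f x -> differentiable g x ->
  'D_v (fun y => omega (a + lift_dir e (f y)) (a' + lift_dir e' (g y))) x =
  omega (lift_dir e ('D_v f x)) (a' + lift_dir e' (g x)) +
  omega (a + lift_dir e (f x)) (lift_dir e' ('D_v g x)).
Proof.
move=> df dg; pose A y := a + lift_dir e (f y).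
have formE w xi : omega w (a' + lift_dir e' xi) =
    omega w a' + \sum_(j < n) xi 0 j * omega w (tnth e' (rshift 1 j)).
  rewrite linearDr /lift_dir linear_sumr; congr (_ + _).
  by apply: eq_bigr => j _; rewrite linearZr_LR.
have dgj j : is_derive x v (fun y => g y 0 j) ('D_v g x 0 j).
  have dj : differentiable (fun y => g y 0 j) x.
    exact: (differentiable_comp dg (differentiable_coord _ _ _)).
  apply: DeriveDef; first exact: diff_derivable.
  by rewrite derive_mx ?mxE//; exact: diff_derivable.
rewrite (_ : (fun y => _) = (fun y => omega (A y) a') +
    \sum_(j < n) (fun y => g y 0 j * omega (A y) (tnth e' (rshift 1 j)))); last first.
  by apply/funext => y; rewrite formE fct_sumE.
have dA w := derive_form_l e a w v df.
have D := is_deriveD (dA a') (is_derive_sum (fun j =>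
  is_deriveM (dgj j) (dA (tnth e' (rshift 1 j))))).
rewrite (derive_val (is_derive := D)) formE -addrA; congr (_ + _).
have -> : omega (a + lift_dir e (f x)) (lift_dir e' ('D_v g x)) =
   \sum_(j < n) 'D_v g x 0 j * omega (A x) (tnth e' (rshift 1 j)).
  by rewrite /lift_dir linear_sumr; apply: eq_bigr => j _; rewrite linearZr_LR.
rewrite -big_split; apply: eq_bigr => j _ /=; congr (_ + _).
exact: mulrC.
Qed.

End isotropy.

(** * Isotropy of the lifted tangent spaces, and the tangent map in one chart *)

Section tangent_map.
Context {R : realType} {V : vectType R} (omega : {skew_symmetric V}).

Lemma skewE u v : omega u v = - omega v u.
Proof. by rewrite hermC expr1 mulN1r. Qed.

Lemma skew_diag u : omega u u = 0.
Proof. by apply/eqP; rewrite -eqNr -skewE. Qed.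

Context {p m : nat} (e : (1 + m).-tuple V) (c : 'rV[R]_p -> 'rV[R]_m).
Context (U : set 'rV[R]_p).
Hypotheses (oU : open U) (sc : smooth_on U c).
Hypothesis contact_c :
  forall u, U u -> forall v, contact_plane omega e (c u) ('d c u v).

Let Cc d : Ck d U c. Proof. exact: (smooth_onP _ _).1. Qed.

(** The contact condition makes the lift of [c u + 'd c u v] orthogonal to that of [c u];
    subtracting the latter, which is orthogonal to itself, leaves the direction. *)
Lemma contact_isotropic1 u v : U u ->
  omega (lift_pt e (c u)) (lift_dir e ('D_v c u)) = 0.
Proof.
move=> Uu; have := contact_c Uu v; rewrite /contact_plane /proj_tangent/=.
rewrite !gr_chart1E orthov11 -deriveE; last exact: (Ck_differentiable (Cc 0)).
by rewrite lift_ptD linearDl/= skew_diag add0r skewE oppr_eq0 => /eqP.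
Qed.

(** Differentiating [contact_isotropic1] yields a term skew in [v] and [w] plus a term symmetric by
    [derive_comm_mx]; exchanging [v] and [w] and comparing leaves twice the skew term equal to 0. *)
Lemma contact_isotropic2 u v w : U u ->
  omega (lift_dir e ('D_w c u)) (lift_dir e ('D_v c u)) = 0.
Proof.
move=> Uu; have dc : differentiable c u by exact: (Ck_differentiable (Cc 0)).
have dDc a : differentiable ('D_a c) u.
  exact: (Ck_differentiable (Ck_derive a (Cc 1))).
have diff_iso a b : omega (lift_dir e ('D_b c u)) (lift_dir e ('D_a c u)) +
    omega (lift_pt e (c u)) (lift_dir e ('D_b ('D_a c) u)) = 0.
  (* The base vector [0] makes the second argument a pure direction. *)
  have := derive_form omega e e (tnth e (lshift m 0)) 0 b dc (dDc a).
  rewrite add0r => <-; rewrite -(derive_cst (0 : R) u b); apply: near_eq_derive.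
  have nU : \forall y \near u, U y by exact: open_nbhs_nbhs.
  by apply: filterS nU => y Uy; rewrite add0r; exact: contact_isotropic1.
have := diff_iso v w; rewrite (derive_comm_mx v w oU (Cc 2) Uu) => E1.
have := diff_iso w v; rewrite skewE => /eqP; rewrite addrC subr_eq0 => /eqP E2.
by move: E1; rewrite E2 -mulr2n => /eqP; rewrite mulrn_eq0 => /eqP.
Qed.

(** The affine coordinates of the tangent map in the chart that defines it; see [val_Tan]. *)
Definition tan_pt (x : 'rV[R]_(p + p)) : 'rV[R]_m :=
  c (rsubmx x) + \sum_(j < p) lsubmx x 0 j *: 'D_(delta_mx 0 j) c (rsubmx x).

Lemma tan_pt_orth x : U (rsubmx x) ->
  omega (lift_pt e (c (rsubmx x))) (lift_pt e (tan_pt x)) = 0.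
Proof.
move=> Ux; rewrite /tan_pt lift_ptD linearDr/= skew_diag add0r.
rewrite [lift_dir e (\sum_(_ < _) _)]linear_sum linear_sumr big1// => j _.
by rewrite linearZ linearZr_LR/= contact_isotropic1// mulr0.
Qed.

Lemma tan_pt_orth_dir x v : U (rsubmx x) ->
  omega (lift_dir e ('D_v c (rsubmx x))) (lift_pt e (tan_pt x)) = 0.
Proof.
move=> Ux; rewrite /tan_pt lift_ptD linearDr/= skewE contact_isotropic1// oppr0 add0r.
rewrite [lift_dir e (\sum_(_ < _) _)]linear_sum linear_sumr big1// => j _.
by rewrite linearZ linearZr_LR/= contact_isotropic2// mulr0.
Qed.

Let UT := (rsubmx : 'rV[R]_(p + p) -> _) @^-1` U.

Lemma open_preimage_rsubmx : open UT.
Proof.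
apply: open_comp => // x _; exact: continuous_rsubmx.
Qed.

Lemma Ck_rsubmx (F : normedModType R) d (f : 'rV[R]_p -> F) :
  Ck d U f -> Ck d UT (f \o rsubmx).
Proof. move=> cf; apply: Ck_comp_linear cf; exact: continuous_rsubmx. Qed.

Lemma Ck_tan_pt d : Ck d UT tan_pt.
Proof.
have oUT := open_preimage_rsubmx.
apply: CkD => //; first exact: Ck_rsubmx.
apply: Ck_sum => // j.
have cD := Ck_rsubmx (Ck_derive (delta_mx 0 j) (Cc d.+1)).
apply: Ck_mx => // i k; under eq_fun do rewrite mxE.
apply: CkM => //; last exact: Ck_coord cD.
apply: (@sub_Ck _ _ _ _ _ (lsubmx @^-1` [set: 'rV[R]_p])) => //.
apply: (@Ck_comp_linear _ _ _ _ d _ lsubmx (fun s : 'rV[R]_p => s 0 j : R)).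
  exact: continuous_lsubmx.
apply: (@Ck_coord _ _ d [set: 'rV[R]_p] 1 p id); first exact: openT.
exact: Ck_id.
Qed.

End tangent_map.

(** * The tangent map read in an arbitrary affine chart [e'] *)

Section tangent_frontal.
Context {R : realType} {V : vectType R} (omega : {skew_symmetric V}).
Context {p m : nat} (e e' : (1 + m).-tuple V) (i : 'rV[R]_p -> Gr 1 V).
Context (U : set 'rV[R]_p).
Let c := gr_coord e \o i.
Hypotheses (be : basis_of fullv e) (be' : basis_of fullv e').
Hypotheses (oU : open U) (sc : smooth_on U c).
Hypothesis contact_c :
  forall u, U u -> forall v, contact_plane omega e (c u) ('d c u v).
Hypothesis nondeg : nondegenerate omega.

Lemma val_Tan x : val (Tan e i x) = gr_chart e (tan_pt c x).
Proof. by rewrite val_insubd dim_gr_chart1// eqxx. Qed.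

Let UT := (rsubmx : 'rV[R]_(p + p) -> _) @^-1` U.
(** [T x] is the representative of the tangent point normalised in [e]; on [W], [tau x] is the
    factor between it and the one normalised in [e']. *)
Let T x := lift_pt e (tan_pt c x).
Let tau x : R := coord e' (lshift m 0) (T x).
(* W is the set of points that Tan e i maps into the chart e'. *)
Let W := UT `&` [set x | tau x != 0].
Let oUT : open UT. Proof. exact: open_preimage_rsubmx. Qed.

Lemma Ck_coord_T d b : Ck d UT (fun x => coord e' b (T x)).
Proof.
apply: (Ck_affine (f := tan_pt c) (a := coord e' b (tnth e (lshift m 0)))
  (b := fun j => coord e' b (tnth e (rshift 1 j)))) => //.
  exact: Ck_tan_pt.
move=> y; rewrite /T /lift_pt linearD /lift_dir linear_sum; congr (_ + _).
by apply: eq_bigr => j _; rewrite linearZ.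
Qed.

Lemma open_Tan_chart : open W.
Proof.
apply: open_neq0 => // x Ux; exact: Ck_differentiable (Ck_coord_T 0 _) Ux.
Qed.

Lemma Tan_chart0 : U 0 -> gr_dom e' (Tan e i 0) -> W 0.
Proof.
move=> U0 [A AE]; split; first by rewrite /UT/= linear0.
apply: (gr_chart1_coord_neq0 (x := A)) => //; first exact: lift_pt_neq0.
by rewrite AE val_Tan gr_chart1E memv_line.
Qed.

(** An explicit formula for the [e']-coordinates of the tangent map, valid on [W], from which their
    smoothness is deduced. *)
Let g x := \row_j (coord e' (rshift 1 j) (T x) / tau x).

Let T_g x : W x -> T x = tau x *: lift_pt e' (g x).
Proof. by move=> [_ tx0]; exact: lift_pt_basis. Qed.

Lemma gr_chart_g x : W x -> gr_chart e' (g x) = val (Tan e i x).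
Proof.
move=> Wx; have [_ /= tx0] := Wx; rewrite val_Tan !gr_chart1E -/(T x).
apply/eqP; rewrite eqEsubv; apply/andP; split; rewrite -memvE.
  apply/vlineP; exists (tau x)^-1.
  by rewrite (T_g Wx) scalerA mulVf// scale1r.
by rewrite (T_g Wx) memvZ// memv_line.
Qed.

Let h := gr_coord e' \o Tan e i.

Let hE x : W x -> h x = g x.
Proof. by move=> Wx; apply: gr_coordE => //; exact: gr_chart_g. Qed.

Let T_h x : W x -> T x = tau x *: lift_pt e' (h x).
Proof. by move=> Wx; rewrite hE//; exact: T_g. Qed.

Lemma Ck_Tan d : Ck d W h.
Proof.
have oW := open_Tan_chart; apply: (@eq_Ck _ _ _ _ _ g) => //; first by move=> x /hE.
have cW b : Ck d W (fun x => coord e' b (T x)) by apply: sub_Ck (Ck_coord_T d b) => x [].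
apply: Ck_mx => // k j; under eq_fun do rewrite mxE.
apply: CkM; [exact: oW|exact: cW|].
by apply: CkV; [exact: oW|move=> y []|exact: cW].
Qed.

Lemma Tan_orth x : W x ->
  omega (lift_pt e (c (rsubmx x))) (lift_pt e' (h x)) = 0.
Proof.
move=> Wx; have [Ux /= tx0] := Wx.
have := tan_pt_orth sc contact_c Ux; rewrite -/(T x) (T_h Wx) linearZr_LR/=.
by move=> /eqP; rewrite mulf_eq0 (negPf tx0) => /eqP.
Qed.

Lemma Tan_orth_dir x v : W x ->
  omega (lift_dir e ('D_v c (rsubmx x))) (lift_pt e' (h x)) = 0.
Proof.
move=> Wx; have [Ux /= tx0] := Wx.
have := tan_pt_orth_dir oU sc contact_c v Ux; rewrite -/(T x) (T_h Wx) linearZr_LR/=.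
by move=> /eqP; rewrite mulf_eq0 (negPf tx0) => /eqP.
Qed.

(** Differentiating [Tan_orth] along [v] gives two terms, and [Tan_orth_dir] kills the one where [c]
    is differentiated. *)
Lemma derive_Tan_orth x v : W x ->
  omega (lift_pt e (c (rsubmx x))) (lift_dir e' ('D_v h x)) = 0.
Proof.
move=> Wx; have [Ux _] := Wx.
have dc : differentiable (c \o rsubmx) x.
  exact: (Ck_differentiable (Ck_rsubmx ((smooth_onP _ _).1 sc 0%N)) Ux).
have dh : differentiable h x by exact: Ck_differentiable (Ck_Tan 0) Wx.
have := derive_form omega e e' (tnth e (lshift m 0)) (tnth e' (lshift m 0)) v dc dh.
(* The derivative of [c \o rsubmx] along [v] is that of [c] along [rsubmx v]. *)
rewrite derive_comp_linear Tan_orth_dir// add0r => <-.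
rewrite -(derive_cst (0 : R) x v); apply: near_eq_derive.
have nW : \forall y \near x, W y.
  by apply: open_nbhs_nbhs; split => //; exact: open_Tan_chart.
by apply: filterS nW => y Wy; exact: Tan_orth.
Qed.

(* By [omega_eta], [hyperplane (eta x)] is the direction, in the coordinates
   of e', of P(v^s) for v = lift_pt e (c u). *)
Let eta (x : 'rV[R]_(p + p)) :=
  \row_j omega (lift_pt e (c (rsubmx x))) (tnth e' (rshift 1 j)).

Lemma omega_eta x xi : omega (lift_pt e (c (rsubmx x))) (lift_dir e' xi) =
  \sum_(j < m) xi 0 j * eta x 0 j.
Proof.
rewrite linear_sumr; apply: eq_bigr => j _.
by rewrite linearZr_LR/= mxE.
Qed.

Lemma smooth_eta : smooth_on W eta.
Proof.
apply/smooth_onP => d; apply: (@sub_Ck _ _ _ _ _ UT) => [x []//|].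
apply: Ck_mx => // k j; under eq_fun do rewrite mxE.
set w := tnth e' _.
apply: (Ck_affine (f := c \o rsubmx) (a := omega (tnth e (lshift m 0)) w)
  (b := fun j => omega (tnth e (rshift 1 j)) w)) => //.
  exact/Ck_rsubmx/((smooth_onP _ _).1 sc).
move=> y; rewrite /lift_pt linearDl linear_sumlz; congr (_ + _).
by apply: eq_bigr => l _; rewrite linearZl.
Qed.

(** If [eta x] vanished, the lift of [c] would be orthogonal to every vector of [e'] but the first,
    then by [Tan_orth] to the first as well, contradicting nondegeneracy. *)
Lemma eta_neq0 x : W x -> eta x != 0.
Proof.
move=> Wx; apply/eqP => eta0.
have dir0 xi : omega (lift_pt e (c (rsubmx x))) (lift_dir e' xi) = 0.
  by rewrite omega_eta eta0 big1// => j _; rewrite mxE mulr0.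
have pt0 : omega (lift_pt e (c (rsubmx x))) (tnth e' (lshift m 0)) = 0.
  by have := Tan_orth Wx; rewrite linearDr /= dir0 addr0.
have : lift_pt e (c (rsubmx x)) \in orthov omega fullv.
  apply/mem_orthovP => w _.
  rewrite (coord_basis be' (memvf w)) linear_sumr big_split_ord big_ord1.
  rewrite -tnth_nth linearZr_LR/= pt0 mulr0 add0r.
  rewrite -[RHS](dir0 (\row_j coord e' (rshift 1 j) w)).
  rewrite linear_sumr; apply: eq_bigr => j _.
  by rewrite mxE (tnth_nth 0).
by rewrite (eqP nondeg) memv0; apply/negP; exact: lift_pt_neq0.
Qed.

(** The image lies in the hyperplane by [derive_Tan_orth]; at a regular point the differential is
    injective, so both have dimension [p + p]. *)
Lemma tangent_image_Tan x : (p + p = m.-1)%N -> W x -> Reg h x ->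
  tangent_image h x = hyperplane (eta x).
Proof.
move=> pm Wx inj; apply/eqP; rewrite eqEdim; apply/andP; split.
  apply/subvP => _ /memv_imgP[v _ ->]; rewrite lfunE/= mem_hyperplane.
  rewrite -omega_eta -deriveE; last exact: Ck_differentiable (Ck_Tan 0) Wx.
  by rewrite derive_Tan_orth.
rewrite dim_hyperplane ?eta_neq0// /tangent_image limg_dim_eq.
  by rewrite dimvf [dim _]mul1n pm.
suff /eqP -> : lker (linfun ('d h x)) == 0%VS by rewrite capv0.
by apply/lker0P => u v; rewrite !lfunE/=; exact: inj.
Qed.

End tangent_frontal.

Theorem corollary9p3 (R : realType) (V : vectType R)
    (omega : {skew_symmetric V})
    (dimV : \dim {:V} = 6%N)
    (symplectic_omega : is_psymplectic omega)
    (i : 'rV[R]_2 -> Gr 1 V)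
    (legendre_i : legendre_immersion_germ 5 omega i)
    (e : (1 + 5).-tuple V)
    (chart_e : chart_at e (i 0))
    (dense_Reg_Tan : proj_dense_Reg_germ 5 (Tan e i)) :
  proj_frontal_germ 5 (Tan e i).
Proof.
(* The Legendre condition is used in the chart [e] that defines the tangent map; frontality is
   checked in an arbitrary chart [e']. *)
move=> e' chart_e'; have [_ [U [[oU U0] sc _ contact_c]]] := legendre_i e chart_e.
have [[be _] [be' dom0]] := (chart_e, chart_e').
have [nondeg _ _] := symplectic_omega.
pose c := gr_coord e \o i.
pose W := (rsubmx @^-1` U) `&`
  [set x : 'rV[R]_(2 + 2) | coord e' (lshift 5 0) (lift_pt e (tan_pt c x)) != 0].
have oW : open W by exact: open_Tan_chart.
have W0 : W 0 by exact: Tan_chart0.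
have chartW x : W x -> chart_at e' (Tan e i x).
  by move=> Wx; split=> //; eexists; exact: gr_chart_g Wx.
split.
  have nW : \forall x \near (0 : 'rV[R]_(2 + 2)), W x by exact: open_nbhs_nbhs.
  by apply: filterS nW => x /chartW[].
have [U1 [oU1 U10] dense] := dense_Reg_Tan.
exists (W `&` U1); split.
- by split; [exact: openI|split].
- apply/smooth_onP => d; apply: (@sub_Ck _ _ _ _ _ W) => [x []//|].
  exact: Ck_Tan.
(* Shrinking [N] to the open set [W] keeps the nearby regular point in the chart [e'], to which its
   projective regularity is then specialised. *)
- move=> x [Wx U1x] N Nx.
  have nW : \forall x \near x, (W `&` U1) x.
    by apply: open_nbhs_nbhs; split=> //; exact: openI.
  have [y [[U1y Ry] [Ny WU1y]]] := dense x U1x _ (filterI Nx nW).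
  by exists y; split=> //; split=> //; apply: Ry; apply: chartW; case: WU1y.
pose eta (x : 'rV[R]_(2 + 2)) :=
  \row_j omega (lift_pt e (c (rsubmx x))) (tnth e' (rshift 1 j)).
have eta0 x : W x -> eta x != 0 := eta_neq0 be be' sc contact_c nondeg (x := x).
have dimH x : W x -> \dim (hyperplane (eta x)) == 4.
  by move=> Wx; rewrite dim_hyperplane// eta0.
(* The default of [insubd]; by [dimH] it can be taken only outside [W]. *)
pose L0 : Gr (2 + 2) 'rV[R]_5 := exist _ (hyperplane (eta 0)) (dimH 0 W0).
pose F x := insubd L0 (hyperplane (eta x)).
have FE x : W x -> val (F x) = hyperplane (eta x).
  by move=> Wx; rewrite val_insubd dimH.
exists F; split=> x [Wx _].
  (* Since [eta] is smooth and nonzero on all of [W], the lift is smooth at singular points of the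
     tangent map too. *)
  apply: (@gr_smooth_hyperplane _ _ _ _ W eta) => //; first exact: smooth_eta.
  exact: eta0.
move=> Rx; rewrite FE//; apply/esym.
by apply: (tangent_image_Tan be be' oU sc contact_c nondeg _ Wx).
Qed.
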